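(* Let $n\ge 1$ and let $K$ be a random variable with values in $\{1,\dots,n\}$. Let $T_{\mathrm{LCCP}}(n)$ be the number of samples needed to determine the labels of all $n$ coupons in the Mixed Labeled Coupon Collector Problem with sample-size distribution $K$, and let $T_{\mathrm{CCP}}(n-1)$ be the number of samples needed to collect at least $n-1$ distinct coupons in the Coupon Collector Problem with group drawings with sample-size distribution $K$. Then $$\mathbb{E}[T_{\mathrm{LCCP}}(n)] > \mathbb{E}[T_{\mathrm{CCP}}(n-1)].$$
   Context: Coupon Collector Problem with group drawings ($K$-CCP): there are $n$ coupons $C$; samples are independent, and each sample is obtained by drawing a size $k$ according to the distribution of $K$ and then a uniformly random $k$-element subset of $C$; a coupon is collected once it appears in some sample. Mixed Labeled Coupon Collector Problem ($K$-LCCP): there are $n$ coupons $C$ and $n$ labels $L$ with an unknown bijection $\sigma:C\to L$; samples are drawn as in the $K$-CCP (size from $K$, then a uniformly random subset $S\subseteq C$ of that size), independently, but the collector observes only the pair of sets $(S,\sigma(S))$, not which label goes with which coupon. After samples $(S_1,\sigma(S_1)),\dots,(S_t,\sigma(S_t))$, a bijection $f$ from the observed coupons $\bigcup_i S_i$ to the observed labels $\bigcup_i\sigma(S_i)$ is consistent if $f(S_i)=\sigma(S_i)$ for all $i$; a coupon's label is determined if it has been observed and all consistent $f$ agree on it. $T_{\mathrm{LCCP}}(n)$ is the least $t$ at which all coupons' labels are determined (possibly $+\infty$). *)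

(* Defs.v *)
From mathcomp Require Import all_boot all_order all_algebra.
From mathcomp Require Import all_classical all_reals all_analysis.

Set Implicit Arguments.
Unset Strict Implicit.
Unset Printing Implicit Defensive.

Import Order.TTheory GRing.Theory Num.Theory.
Local Open Scope classical_set_scope.
Local Open Scope ring_scope.

Section Sampling.
Context {d : measure_display} {T : measurableType d} {R : realType}.
Variables (P : probability T R) (C : finType).

(* {set C} carries the discrete sigma-algebra. *)
Definition measurable_samples (S : nat -> T -> {set C}) : Prop :=
  forall i (B : set {set C}), measurable (S i @^-1` B).

Definition independent_samples (S : nat -> T -> {set C}) : Prop :=
  forall (J : seq nat) (B : nat -> set {set C}), uniq J ->
    P (\bigcap_(j in [set` J]) S j @^-1` B j) =
    (\prod_(j <- J) P (S j @^-1` B j))%E.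

Definition uniform_subset_pmf (k : nat) (A : {set C}) : R :=
  if #|A| == k then (#|[set B : {set C} | #|B| == k]%SET|%:R)^-1 else 0.

(* First a size k is drawn from the law muK, then a uniform k-subset of C:
   the mass function of one sample is the corresponding mixture. *)
Definition group_drawing_pmf (muK : set nat -> \bar R) (A : {set C}) : \bar R :=
  (\sum_(0 <= k < #|C|.+1) muK [set k] * (uniform_subset_pmf k A)%:E)%E.

Definition group_drawings (muK : set nat -> \bar R)
    (S : nat -> T -> {set C}) : Prop :=
  [/\ measurable_samples S,
      forall i (A : {set C}), P (S i @^-1` [set A]) = group_drawing_pmf muK A
    & independent_samples S].

End Sampling.

(* ereal_inf set0 = +oo covers the case where Q never holds. *)
Definition first_time (R : realType) (Q : nat -> Prop) : \bar R :=
  ereal_inf [set (t%:R)%:E | t in Q].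

Definition seen (X : finType) (s : nat -> {set X}) (t : nat) : {set X} :=
  (\bigcup_(i < t) s i)%SET.

Definition T_CCP (R : realType) (C : finType) (m : nat)
    (s : nat -> {set C}) : \bar R :=
  first_time R (fun t => (m <= #|seen s t|)%N).

Section Labels.
Variables (C L : finType).

(* In what follows o i is the i-th observed pair (coupon set, label set). *)
Definition seen_coupons (o : nat -> {set C} * {set L}) (t : nat) : {set C} :=
  seen (fun i => (o i).1) t.

Definition seen_labels (o : nat -> {set C} * {set L}) (t : nat) : {set L} :=
  seen (fun i => (o i).2) t.

(* A bijection from the seen coupons to the seen labels is represented by a
   total f : C -> L, of which only the values on the seen coupons matter. *)
Definition consistent (o : nat -> {set C} * {set L}) (t : nat)
    (f : C -> L) : Prop :=
  [/\ {in seen_coupons o t &, injective f},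
      (f @: seen_coupons o t)%SET = seen_labels o t
    & forall i, (i < t)%N -> (f @: (o i).1)%SET = (o i).2].

Definition determined (o : nat -> {set C} * {set L}) (t : nat) (c : C) : Prop :=
  c \in seen_coupons o t /\
  forall f g : C -> L, consistent o t f -> consistent o t g -> f c = g c.

(* The collector sees S i and sigma(S i) only; sigma enters in no other way. *)
Definition observation (sigma : C -> L) (s : nat -> {set C}) (i : nat) :
  {set C} * {set L} := (s i, (sigma @: s i)%SET).

Definition T_LCCP (R : realType) (sigma : C -> L)
    (s : nat -> {set C}) : \bar R :=
  first_time R (fun t => forall c, determined (observation sigma s) t c).

End Labels.

(* Main.v *)
Require Import Defs.
From mathcomp Require Import all_boot all_order perm all_algebra.
From mathcomp Require Import all_classical all_reals all_analysis.
From mathcomp Require Import measurable_realfun.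

(** Write each expected time as the sum over t of the probability that the
    stopping condition fails after t samples. These events depend only on the
    first t samples, so their probabilities agree on any two probability spaces
    carrying the drawings, and both expectations can be compared termwise on
    one space. A determined coupon has been seen, whence the inequality of all
    terms. Strictness: let A be a nonempty set of positive mass; by symmetry all
    sets of size #|A| have the same mass. If A is not everything, copies of A
    that avoid a coupon b but cover all the others leave b unseen; if A is
    everything, a single full drawing (no drawing at all when n = 1) leaves some
    label undetermined. Either way some term N is strictly smaller. The smaller
    series is finite because each coupon is missed by t drawings with
    probability at most (1 - mass A)^t. *)

Import Order.TTheory GRing.Theory Num.Theory.

Local Open Scope ereal_scope.

(** * Expected stopping times as series of tail probabilities *)

Section first_time_theory.
Context {R : realType}.

(** By monotonicity the times at which [Q] fails are exactly those below the first success, so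
    counting them gives that time. If [Q] never holds, both sides are infinite. *)
Lemma first_time_nneseries (Q : set nat)
    (Qmono : forall t u, (t <= u)%N -> Q t -> Q u) :
  first_time R Q = \sum_(0 <= t <oo) (\1_(~` Q)%classic t)%:E.
Proof.
have ge0 t : 0 <= (\1_(~` Q)%classic t)%:E :> \bar R by rewrite lee_fin.
have [[t0 Qt0]|Q0] := pselect (exists t, Q t); last first.
  have nQ t : ~ Q t by move=> Qt; apply: Q0; exists t.
  rewrite /first_time.
  have -> : [set (t%:R)%:E | t in Q]%classic = set0 :> set (\bar R).
    by apply/seteqP; split => // x [t /nQ].
  rewrite ereal_inf0; apply/esym/eqyP => r r0.
  (* Every indicator is 1 here, so the first [N] terms sum to [N], and the series exceeds any real
     [r]. *)
  have [N rN] : exists N : nat, (r <= N%:R)%R.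
    by exists (Num.truncn r).+1; apply/ltW/truncnS_gt.
  apply: (@le_trans _ _ (\sum_(0 <= t < N) (\1_(~` Q)%classic t)%:E)).
    rewrite (eq_bigr (fun=> 1)).
      by rewrite sumEFin sumr_const_nat subn0 lee_fin.
    by move=> t _; rewrite indicE mem_set//; exact: nQ.
  exact: nneseries_lim_ge.
have exQ : exists t, `[< Q t >] by exists t0; apply/asboolP.
have [N /asboolP QN minN] := ex_minnP exQ.
have -> : first_time R Q = N%:R%:E.
  apply/eqP; rewrite eq_le; apply/andP; split.
    by apply: ereal_inf_lbound; exists N.
  apply: le_ereal_inf_tmp => _ [t Qt <-]; rewrite lee_fin ler_nat.
  by apply: minN; apply/asboolP.
rewrite (nneseries_split 0 N)// add0n eseries0 ?adde0; last first.
  move=> t Nt _; rewrite indicE memNset//= => nQt.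
  exact/nQt/(Qmono N).
rewrite (@eq_big_nat _ _ _ _ _ _ (fun=> 1)).
  by rewrite sumEFin sumr_const_nat subn0.
move=> t /andP[_ tN]; rewrite indicE mem_set//= => Qt.
by have /minN : `[< Q t >] by [apply/asboolP]; rewrite leqNgt tN.
Qed.

Lemma integral_first_time {d : measure_display} {T : measurableType d}
    (P : probability T R) (Q : T -> set nat)
    (Qmono : forall w t u, (t <= u)%N -> Q w t -> Q w u)
    (Qmeas : forall t, measurable [set w | ~ Q w t]%classic) :
  \int[P]_w first_time R (Q w) =
  \sum_(0 <= t <oo) P [set w | ~ Q w t]%classic.
Proof.
under eq_integral => w _ do rewrite (first_time_nneseries _ (Qmono w)).
have indE t w : (\1_(~` Q w)%classic t = \1_[set w | ~ Q w t]%classic w :> R)%R.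
  by rewrite !indicE.
rewrite integral_nneseries//.
- apply: eq_eseriesr => t _; under eq_integral do rewrite indE.
  by rewrite integral_indic// setIT.
- move=> t; under eq_fun do rewrite indE.
  exact/measurable_EFinP/measurable_indic.
Qed.

(** Isolate the [N]-th terms. The rest of the [u] series is finite, so adding it keeps the
    inequality strict, even when the [v] series diverges. *)
Lemma lt_nneseries (u v : nat -> \bar R) (N : nat) (u_ge0 : forall t, 0 <= u t)
    (le_uv : forall t, u t <= v t) (lt_uv : u N < v N)
    (u_fin : \sum_(0 <= t <oo) u t < +oo) :
  \sum_(0 <= t <oo) u t < \sum_(0 <= t <oo) v t.
Proof.
have v_ge0 t : 0 <= v t by apply: le_trans (le_uv t).
move: u_fin; rewrite (@nneseriesD1 _ _ N)//.
rewrite [in X in _ -> _ < X](@nneseriesD1 _ _ N)//.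
set a := \sum_(_ <= _ <oo | _) _; set b := \sum_(_ <= _ <oo | _) v _ => u_fin.
have a_ge0 : 0 <= a by apply: nneseries_ge0 => t _ _.
have a_fin : a \is a fin_num.
  by rewrite ge0_fin_numE// (le_lt_trans _ u_fin)// leeDr.
by apply: lte_leD => //; exact: lee_nneseries.
Qed.

End first_time_theory.

(** * Events that depend on finitely many drawings *)

Definition prefix_determined {X : Type} (t : nat) (Q : (nat -> X) -> Prop) :=
  forall s s', (forall i, (i < t)%N -> s i = s' i) -> Q s -> Q s'.

Section drawings_theory.
Context {d : measure_display} {T : measurableType d} {R : realType}.
Context {P : probability T R} {C : finType} {S : nat -> T -> {set C}}.
Hypothesis S_meas : measurable_samples S.

Local Open Scope classical_set_scope.

Lemma prefix_bigcap (B : nat -> set {set C}) (t : nat) :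
  [set w | forall i, (i < t)%N -> B i (S i w)] =
  \bigcap_(j in [set` iota 0 t]) S j @^-1` B j.
Proof.
apply/seteqP; split => w /= Bw i.
  by rewrite /= mem_iota => /andP[_]; exact: Bw.
by move=> it; apply: Bw; rewrite /= mem_iota.
Qed.

Lemma measurable_prefix (B : nat -> set {set C}) (t : nat) :
  measurable [set w | forall i, (i < t)%N -> B i (S i w)].
Proof.
rewrite prefix_bigcap; by apply: fin_bigcap_measurable => // j _.
Qed.

(** Splits the event into finitely many cylinders, one per admissible [t]-tuple. A tuple is padded
    with empty sets to an infinite sequence; [Q_loc] makes the padding harmless. *)
Lemma prefix_event_bigcup (t : nat) (Q : (nat -> {set C}) -> Prop)
    (Q_loc : prefix_determined t Q) :
  [set w | Q (fun i => S i w)] =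
  \bigcup_(a in [set a : t.-tuple {set C} | Q (nth finset.set0 a)])
    [set w | forall i, (i < t)%N -> S i w = nth finset.set0 a i].
Proof.
apply/seteqP; split => w /= => [Qw|[a /= Qa aw]].
  have aE i : (i < t)%N -> S i w = nth finset.set0 [tuple S i w | i < t] i.
    by move=> it; rewrite -[i]/(val (Ordinal it)) nth_mktuple.
  by exists [tuple S i w | i < t] => //=; exact: Q_loc Qw.
by apply: Q_loc Qa => i it; rewrite aw.
Qed.

Lemma measurable_prefix_event (t : nat) (Q : (nat -> {set C}) -> Prop)
    (Q_loc : prefix_determined t Q) :
  measurable [set w | Q (fun i => S i w)].
Proof.
rewrite (prefix_event_bigcup _ _ Q_loc); apply: fin_bigcup_measurable => // a _.
exact: (measurable_prefix (fun i => [set nth finset.set0 a i])).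
Qed.

Hypothesis S_indep : independent_samples P S.

Lemma prob_prefix (B : nat -> set {set C}) (t : nat) :
  P [set w | forall i, (i < t)%N -> B i (S i w)] =
  (\prod_(i < t) P (S i @^-1` B i))%E.
Proof.
rewrite prefix_bigcap S_indep ?iota_uniq//.
by rewrite -(big_mkord xpredT (fun j => P (S j @^-1` B j))) /index_iota subn0.
Qed.

Lemma prob_prefix_event (t : nat) (Q : (nat -> {set C}) -> Prop)
    (Q_loc : prefix_determined t Q) :
  P [set w | Q (fun i => S i w)] =
  (\sum_(a \in [set a : t.-tuple {set C} | Q (nth finset.set0 a)])
    \prod_(i < t) P (S i @^-1` [set nth finset.set0 a i]))%E.
Proof.
rewrite (prefix_event_bigcup _ _ Q_loc) measure_fin_bigcup//.
- apply: eq_fsbigr => a _.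
  exact: (prob_prefix (fun i => [set nth finset.set0 a i])).
- exact: finite_finset.
- move=> a b _ _ [w [aw bw]]; apply: val_inj.
  apply: (@eq_from_nth _ finset.set0); first by rewrite !size_tuple.
  by move=> i; rewrite size_tuple => it; rewrite -aw// bw.
- move=> a _.
  exact: (measurable_prefix (fun i => [set nth finset.set0 a i])).
Qed.

End drawings_theory.

(** Summing over cylinders and using independence, either probability becomes a sum of products of
    [group_drawing_pmf mu], in which the underlying space no longer appears. *)
Lemma eq_prob_group_drawings {R : realType} {C : finType} (mu : set nat -> \bar R)
    {d1 : measure_display} {T1 : measurableType d1} (P1 : probability T1 R)
    (S1 : nat -> T1 -> {set C})
    {d2 : measure_display} {T2 : measurableType d2} (P2 : probability T2 R)
    (S2 : nat -> T2 -> {set C})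
    (S1_drawings : group_drawings P1 mu S1)
    (S2_drawings : group_drawings P2 mu S2)
    (t : nat) (Q : (nat -> {set C}) -> Prop) (Q_loc : prefix_determined t Q) :
  P1 [set w | Q (fun i => S1 i w)]%classic =
  P2 [set w | Q (fun i => S2 i w)]%classic.
Proof.
case: S1_drawings S2_drawings => [m1 law1 ind1] [m2 law2 ind2].
rewrite (prob_prefix_event m1 ind1 _ _ Q_loc).
rewrite (prob_prefix_event m2 ind2 _ _ Q_loc).
apply: eq_fsbigr => a _; apply: eq_bigr => i _.
by rewrite law1 law2.
Qed.

(** * Seen elements, consistent labellings and determined coupons *)

Section seen_theory.
Context {X : finType}.
Implicit Types s : nat -> {set X}.

Lemma mem_seen s t x :
  reflect (exists2 i, (i < t)%N & x \in s i) (x \in seen s t).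
Proof.
apply: (iffP bigcupP) => [[i _ xi]|[i it xi]]; first by exists i.
by exists (Ordinal it).
Qed.

Lemma seen_subset s t u : (t <= u)%N -> seen s t \subset seen s u.
Proof.
move=> tu; apply/fintype.subsetP => x /mem_seen[i it xi].
by apply/mem_seen; exists i => //; exact: leq_trans tu.
Qed.

Lemma eq_seen s s' t :
  (forall i, (i < t)%N -> s i = s' i) -> seen s t = seen s' t.
Proof. by move=> ss'; apply: eq_bigr => i _; exact: ss'. Qed.

End seen_theory.

Section determined_theory.
Context {C L : finType}.
Implicit Types (o : nat -> {set C} * {set L}) (f : C -> L).

Lemma imset_seen o t f : (forall i, (i < t)%N -> (f @: (o i).1)%SET = (o i).2) ->
  (f @: seen_coupons o t)%SET = seen_labels o t.
Proof.
move=> fo; apply/setP => y.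
apply/imsetP/mem_seen => [[x /mem_seen[i it xi] ->]|[i it]].
  by exists i => //; rewrite -fo// imset_f.
by rewrite -fo// => /imsetP[x xi ->]; exists x => //; apply/mem_seen; exists i.
Qed.

Lemma consistent_leq o t u f : (t <= u)%N -> consistent o u f -> consistent o t f.
Proof.
move=> tu [inj_f _ fo].
have fo_t i : (i < t)%N -> (f @: (o i).1)%SET = (o i).2.
  by move=> it; apply/fo/(leq_trans it).
split => //; last exact: imset_seen.
by apply: sub_in2 inj_f; apply/fintype.subsetP; exact: seen_subset.
Qed.

(** Further samples only shrink the set of consistent maps. This is the monotonicity that the
    tail-sum formula requires. *)
Lemma determined_leq o t u c : (t <= u)%N -> determined o t c -> determined o u c.
Proof.
move=> tu [ct det]; split; first exact: (fintype.subsetP (seen_subset _ _ _ tu)) ct.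
move=> f g /(consistent_leq _ _ _ _ tu) ft /(consistent_leq _ _ _ _ tu).
exact: det.
Qed.

Lemma eq_consistent o o' t f : (forall i, (i < t)%N -> o i = o' i) ->
  consistent o t f -> consistent o' t f.
Proof.
move=> eqo [inj_f f_seen fo].
have seen1 : seen_coupons o' t = seen_coupons o t by apply: eq_seen => i /eqo ->.
have seen2 : seen_labels o' t = seen_labels o t by apply: eq_seen => i /eqo ->.
by split; rewrite ?seen1 ?seen2// => i it; rewrite -eqo// fo.
Qed.

Lemma eq_determined o o' t c : (forall i, (i < t)%N -> o i = o' i) ->
  determined o t c -> determined o' t c.
Proof.
move=> eqo [ct det].
have eqo' i : (i < t)%N -> o' i = o i by move=> it; rewrite eqo.
split=> [|f g /(eq_consistent _ _ _ _ eqo') ft /(eq_consistent _ _ _ _ eqo')].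
  by rewrite /seen_coupons (eq_seen _ (fun i => (o i).1))// => i /eqo' ->.
exact: det.
Qed.

Lemma consistent_observation (f sigma : C -> L) (s : nat -> {set C}) t :
  injective f ->
  (forall i, (i < t)%N -> (f @: s i)%SET = (sigma @: s i)%SET) ->
  consistent (observation sigma s) t f.
Proof.
move=> inj_f fs; split=> //; first by move=> x y _ _; exact: inj_f.
exact: imset_seen.
Qed.

(** Supplies the witness for strictness: a finite run of sets of the size of [A], hence of the same
    mass as [A], after which all but at most one coupon have been seen while some label is still
    open. *)
Lemma delayed_labels (sigma : C -> L) (A : {set C}) :
  injective sigma -> A != finset.set0 ->
  exists (N : nat) (s : nat -> {set C}),
    [/\ forall i, #|s i| = #|A|, (#|C| - 1 <= #|seen s N|)%N &
        ~ forall c, determined (observation sigma s) N c].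
Proof.
move=> inj_sigma /set0Pn[a aA].
have [AT|/fintype.subsetPn[b _ bA]] := boolP ([set: C]%SET \subset A).
  have {}AT : A = [set: C]%SET.
    by apply/eqP; rewrite finset.eqEsubset finset.subsetT.
  (* With [a] the only coupon, [#|C| - 1] is 0 and the empty run works, since nothing has been seen
     yet. *)
  have [b ba|onlya] := pickP (predC1 a); last first.
    exists 0%N, (fun=> A); split => //; last by move=> /(_ a)[/mem_seen[]].
    have -> // : #|C| = 1%N.
    apply: (@fintype.eq_card1 _ a) => x; rewrite !inE.
    by apply: esym; exact: negbFE (onlya x).
  exists 1%N, (fun=> A); split => //.
    by rewrite /seen big_ord1 AT cardsT leq_subr.
  (* A transposition preserves the full set, so swapping the labels of [a] and [b] goes
     unnoticed. *)
  move=> /(_ a)[_ /(_ sigma (sigma \o tperm a b))]; rewrite /= tpermL => sigma_ab.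
  have /inj_sigma ab : sigma a = sigma b.
    apply: sigma_ab; apply: consistent_observation => //.
      exact: inj_comp (@perm_inj _ _).
    move=> i _; rewrite imset_comp; suff -> : (tperm a b @: A)%SET = A by [].
    rewrite AT; apply/setP => x; by rewrite -(tpermK a b x) imset_f ?finset.inE.
  by rewrite -ab /= eqxx in ba.
(* The [i]-th copy of [A] is moved to contain the [i]-th coupon, with [a] replacing [b] as target.
   As neither [a] nor [f i] is [b], the transposition fixes [b], which stays outside every copy. *)
pose e i := nth b (enum C) i.
pose f i := if e i == b then a else e i.
have ba : b != a by apply: contraNneq bA => ->.
have fb i : f i != b.
  by rewrite /f; have [_|//] := eqVneq (e i) b; rewrite eq_sym.
exists #|C|, (fun i => tperm a (f i) @: A)%SET.
have bseen : b \notin seen (fun i => tperm a (f i) @: A)%SET #|C|.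
  apply/negP => /mem_seen[i _ /imsetP[x xA bE]].
  have xb : x = b by rewrite -(tpermK a (f i) x) -bE tpermD// eq_sym.
  by rewrite -xb xA in bA.
split.
- by move=> i; rewrite card_imset//; exact: perm_inj.
- rewrite subn1 -(cardC1 b).
  apply/subset_leq_card/fintype.subsetP => x; rewrite !inE => xb.
  apply/mem_seen; exists (index x (enum C)).
    by rewrite cardE index_mem mem_enum.
  have xE : f (index x (enum C)) = x.
    by rewrite /f /e nth_index ?mem_enum// (negbTE xb).
  by rewrite xE; apply/imsetP; exists a; rewrite ?tpermL.
- by move=> /(_ b)[bs _]; move: bseen; rewrite bs.
Qed.

End determined_theory.

(** * The law of one drawing, and finiteness of the coupon collector series *)

Section group_drawing_pmf_theory.
Context {R : realType} {C : finType} (mu : set nat -> \bar R).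
Implicit Types A B : {set C}.

Lemma eq_card_group_drawing_pmf A B :
  #|A| = #|B| -> group_drawing_pmf mu A = group_drawing_pmf mu B.
Proof. by move=> AB; apply: eq_bigr => k _; rewrite /uniform_subset_pmf AB. Qed.

Lemma group_drawing_pmf_set0 :
  mu [set 0%N]%classic = 0 -> group_drawing_pmf mu (finset.set0 : {set C}) = 0.
Proof.
move=> mu0; apply: big1 => k _; rewrite /uniform_subset_pmf cards0.
by case: eqVneq => [<-|_]; rewrite ?mu0 ?mul0e ?mule0.
Qed.

Context {d : measure_display} {T : measurableType d} {P : probability T R}.
Context {S : nat -> T -> {set C}}.
Hypothesis S_drawings : group_drawings P mu S.

(** Otherwise the finitely many fibres of [S 0] would all be null, although they cover a space of
    mass 1. *)
Lemma exists_pmf_gt0 : mu [set 0%N]%classic = 0 ->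
  exists2 A : {set C}, A != finset.set0 & 0 < group_drawing_pmf mu A.
Proof.
case: S_drawings => S_meas S_law _ mu0; apply: contrapT => noA.
have law0 A : P (S 0%N @^-1` [set A])%classic = 0.
  have [->|A0] := eqVneq A finset.set0.
    by rewrite S_law group_drawing_pmf_set0.
  apply/eqP; rewrite eq_le measure_ge0 andbT leNgt S_law.
  by apply/negP => A_gt0; apply: noA; exists A.
have : P setT = 0.
  have -> : setT = (\bigcup_(A in setT) S 0%N @^-1` [set A])%classic.
    by apply/seteqP; split => // w _; exists (S 0%N w).
  rewrite measure_fin_bigcup//.
  - by apply: fsbig1 => A _; exact: law0.
  - exact: finite_finset.
  - by move=> A B _ _ [w [/= <- <-]].
by rewrite probability_setT => /eqP; rewrite onee_eq0.
Qed.

Variable A : {set C}.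
Hypothesis A_neq0 : A != finset.set0.
Hypothesis A_gt0 : 0 < group_drawing_pmf mu A.

Lemma pmf_fin_num B : group_drawing_pmf mu B \is a fin_num.
Proof.
case: S_drawings => S_meas S_law _; rewrite -(S_law 0%N).
exact: fin_num_measure.
Qed.

Let q : R := (1 - fine (group_drawing_pmf mu A))%R.

Let q_lt1 : (q < 1)%R.
Proof. by rewrite /q ltrBlDr ltrDl fine_gt0// A_gt0 ltey_eq pmf_fin_num. Qed.

Let q_ge0 : (0 <= q)%R.
Proof.
case: S_drawings => S_meas S_law _.
rewrite subr_ge0 -lee_fin fineK ?pmf_fin_num// -(S_law 0%N).
exact: probability_le1.
Qed.

(** A transposition carries [A] to a set [B] containing [c], of equal size and so of equal mass.
    Avoiding [c] forces the drawing to differ from [B]. *)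
Lemma prob_avoid_le (c : C) i :
  P (S i @^-1` [set B : {set C} | c \notin B])%classic <= q%:E.
Proof.
case: S_drawings => S_meas S_law _.
have [a aA] := set0Pn _ A_neq0.
pose B := (tperm a c @: A)%SET.
have cB : c \in B by apply/imsetP; exists a; rewrite ?tpermL.
have -> : q%:E = P (~` (S i @^-1` [set B]))%classic.
  rewrite probability_setC// S_law /q EFinB fineK ?pmf_fin_num//.
  congr (_ - _); apply: eq_card_group_drawing_pmf.
  by rewrite card_imset//; exact: perm_inj.
apply: le_measure; rewrite ?inE//.
  exact: measurableC.
by move=> w /= cS SB; rewrite SB cB in cS.
Qed.

Lemma prob_avoid_prefix_le (c : C) t :
  P [set w | forall i, (i < t)%N -> c \notin S i w]%classic <= (q ^+ t)%:E.
Proof.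
case: S_drawings => S_meas S_law S_indep.
rewrite (prob_prefix S_indep
  (fun=> [set B : {set C} | c \notin B]%classic)).
elim: t => [|t IH]; first by rewrite big_ord0.
rewrite big_ord_recr/= exprSr EFinM.
by apply: lee_pmul => //; [exact: prode_ge0 | exact: prob_avoid_le].
Qed.

(** If fewer than [m] coupons are seen, at least one is missed; a union bound over all coupons gives
    the factor [#|C|]. *)
Lemma prob_unseen_le (m t : nat) : (m <= #|C|)%N ->
  P [set w | ~ (m <= #|seen (fun i => S i w) t|)%N]%classic <=
  (geometric #|C|%:R q t)%:E.
Proof.
case: S_drawings => S_meas S_law S_indep mC.
have [a aA] := set0Pn _ A_neq0.
pose F j := [set w | forall i, (i < t)%N -> nth a (enum C) j \notin S i w]%classic.
have F_meas j : measurable (F j).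
  exact: (measurable_prefix S_meas
    (fun=> [set B : {set C} | nth a (enum C) j \notin B]%classic)).
apply: (@le_trans _ _ (P (\big[setU/set0]_(j < #|C|) F j)%classic)).
  apply: le_measure; rewrite ?inE.
  - apply: (measurable_prefix_event S_meas t
      (fun s => ~ (m <= #|seen s t|)%N)).
    by move=> s s' ss'; rewrite (eq_seen s s').
  - by apply: bigsetU_measurable => j _.
  move=> w /= /negP unseen; rewrite -bigcup_mkord.
  have [c cS] : exists c, c \notin seen (fun i => S i w) t.
    apply/not_existsP => allS; move: unseen; rewrite (leq_trans mC)//.
    apply/subset_leq_card/fintype.subsetP => x _; exact/negPn/negP/allS.
  exists (index c (enum C)); first by rewrite /= cardE index_mem mem_enum.
  move=> i it; rewrite nth_index ?mem_enum//.
  by apply: contra cS => cS; apply/mem_seen; exists i.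
apply: (le_trans (Boole_inequality _ _)) => [j _|]; first exact: F_meas.
apply: (@le_trans _ _ (\sum_(j < #|C|) (q ^+ t)%:E)).
  by apply: lee_sum => j _; exact: prob_avoid_prefix_le.
by rewrite sumEFin sumr_const card_ord /geometric/= mulr_natl.
Qed.

Lemma unseen_series_lty (m : nat) : (m <= #|C|)%N ->
  \sum_(0 <= t <oo) P [set w | ~ (m <= #|seen (fun i => S i w) t|)%N]%classic < +oo.
Proof.
move=> mC; apply: (@le_lt_trans _ _
  (\sum_(0 <= t <oo) (geometric #|C|%:R q t)%:E)).
  by apply: lee_nneseries => // t _; exact: prob_unseen_le.
have q_norm : (`|q| < 1)%R by rewrite ger0_norm.
rewrite (_ : \sum_(0 <= t <oo) _ = (#|C|%:R * (1 - q)^-1)%:E) ?ltry//.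
apply/cvg_lim => //; under eq_fun do rewrite sumEFin.
apply: cvg_EFin; [exact: nearW|exact: cvg_geometric_series].
Qed.

End group_drawing_pmf_theory.

(** * Comparison of the two expectations *)

Lemma prefix_determinedN {X : Type} (t : nat) (Q : (nat -> X) -> Prop) :
  prefix_determined t Q -> prefix_determined t (fun s => ~ Q s).
Proof.
move=> Q_loc s s' ss' nQs Qs'; apply: nQs; apply: Q_loc Qs' => i it.
by rewrite ss'.
Qed.

Lemma prefix_determined_seen {C : finType} (m t : nat) :
  prefix_determined t (fun s : nat -> {set C} => m <= #|seen s t|)%N.
Proof. by move=> s s' ss'; rewrite (eq_seen _ _ _ ss'). Qed.

Lemma prefix_determined_labels {C L : finType} (sigma : C -> L) (t : nat) :
  prefix_determined t (fun s => forall c, determined (observation sigma s) t c).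
Proof.
move=> s s' ss' det c; apply: eq_determined (det c) => i it.
by rewrite /observation ss'.
Qed.

Theorem theorem3 (R : realType) (n : nat) (n_ge1 : (1 <= n)%N)
  (C L : finType) (cardC : #|C| = n) (cardL : #|L| = n)
  (sigma : C -> L) (sigma_bij : bijective sigma)
  (d0 : measure_display) (T0 : measurableType d0) (P0 : probability T0 R)
  (K : {RV P0 >-> nat}) (K_range : forall w, (1 <= K w <= n)%N)
  (d1 : measure_display) (T1 : measurableType d1) (P1 : probability T1 R)
  (S1 : nat -> T1 -> {set C})
  (S1_drawings : group_drawings P1 (distribution P0 K) S1)
  (d2 : measure_display) (T2 : measurableType d2) (P2 : probability T2 R)
  (S2 : nat -> T2 -> {set C})
  (S2_drawings : group_drawings P2 (distribution P0 K) S2) :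
  \int[P1]_w T_LCCP R sigma (fun i => S1 i w) >
  \int[P2]_w T_CCP R (n - 1)%N (fun i => S2 i w).
Proof.
pose unseen s t := ~ (n - 1 <= #|seen s t : {set C}|)%N.
pose unlabeled s t := ~ forall c, determined (observation sigma s) t c.
have unseen_loc t :=
  prefix_determinedN t _ (@prefix_determined_seen C (n - 1) t).
have unlabeled_loc t :=
  prefix_determinedN t _ (prefix_determined_labels sigma t).
have [S1_meas S1_law S1_indep] := S1_drawings.
have [S2_meas _ _] := S2_drawings.
(* The tail probabilities are transported from [P2] to [P1], so that both series live on one
   space. *)
have -> : \int[P2]_w T_CCP R (n - 1) (fun i => S2 i w) =
    \sum_(0 <= t <oo) P1 [set w | unseen (fun i => S1 i w) t]%classic.
  rewrite (integral_first_time P2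
    (fun w t => (n - 1 <= #|seen (fun i => S2 i w) t|)%N)).
  - apply: eq_eseriesr => t _.
    exact: (eq_prob_group_drawings _ _ _ _ _
      S2_drawings S1_drawings _ _ (unseen_loc t)).
  - move=> w t u tu /leq_trans; apply; exact/subset_leq_card/seen_subset.
  - by move=> t; exact: (measurable_prefix_event S2_meas _ _ (unseen_loc t)).
have -> : \int[P1]_w T_LCCP R sigma (fun i => S1 i w) =
    \sum_(0 <= t <oo) P1 [set w | unlabeled (fun i => S1 i w) t]%classic.
  apply: (integral_first_time P1 (fun w t => forall c,
    determined (observation sigma (fun i => S1 i w)) t c)).
  - by move=> w t u tu det c; exact: determined_leq (det c).
  - by move=> t; exact: (measurable_prefix_event S1_meas _ _ (unlabeled_loc t)).
have muK0 : distribution P0 K [set 0%N]%classic = 0.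
  rewrite /distribution /pushforward (_ : (_ @^-1` _)%classic = set0) ?measure0//.
  by apply/seteqP; split => // w /= K0; have := K_range w; rewrite K0.
have [A A_neq0 A_gt0] := exists_pmf_gt0 _ S1_drawings muK0.
have [N [s [s_card s_seen s_unlabeled]]] :=
  delayed_labels _ _ (bij_inj sigma_bij) A_neq0.
have seen_meas t : measurable [set w | unseen (fun i => S1 i w) t]%classic.
  exact: (measurable_prefix_event S1_meas _ _ (unseen_loc t)).
have unlabeled_meas t : measurable [set w | unlabeled (fun i => S1 i w) t]%classic.
  exact: (measurable_prefix_event S1_meas _ _ (unlabeled_loc t)).
have sub_events t : ([set w | unseen (fun i => S1 i w) t] `<=`
    [set w | unlabeled (fun i => S1 i w) t])%classic.
  move=> w /= unseen_w det; apply: unseen_w.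
  rewrite -cardC (leq_trans (leq_subr _ _))//.
  by apply/subset_leq_card/fintype.subsetP => c _; have [] := det c.
apply: (@lt_nneseries _ _ _ N) => //.
- by move=> t; apply: le_measure; rewrite ?inE.
(* [E] has positive probability, is disjoint from the unseen event at time [N] and lies in the
   unlabeled one, so its mass separates the two terms. *)
- pose E := [set w | forall i, (i < N)%N -> S1 i w = s i]%classic.
  have E_meas : measurable E.
    exact: (measurable_prefix S1_meas (fun i => [set s i]%classic) N).
  have E_gt0 : 0 < P1 E.
    rewrite (prob_prefix S1_indep (fun i => [set s i]%classic)).
    apply: (@big_ind _ (fun x : \bar R => 0 < x)) => // [x y|i _].
      exact: mule_gt0.
    by rewrite S1_law (eq_card_group_drawing_pmf _ _ _ (s_card i)).
  apply: (@lt_le_trans _ _ (P1 [set w | unseen (fun i => S1 i w) N]%classic + P1 E)).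
    by rewrite lteDl// fin_num_measure.
  rewrite -measureU//.
    apply: le_measure; rewrite ?inE//; first exact: measurableU.
    move=> w /= [/sub_events//|Ew det]; apply: s_unlabeled.
    exact: (prefix_determined_labels _ _ _ _ Ew det).
  apply/seteqP; split => // w /= [unseen_w Ew]; apply: unseen_w.
  by rewrite (eq_seen _ _ _ Ew) -cardC.
- by apply: (unseen_series_lty _ S1_drawings A) => //; rewrite cardC leq_subr.
Qed.
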